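(* Let $S$ be a set of the form $P(\mathbb{Z}) \cap \mathbb{Z}^+$ for some polynomial $P \in \mathbb{Z}[x]$ of degree at least $2$ such that $P(0) = 0$. Then $S$ and its complement are both ladders.
   Context: $\mathbb{Z}^+$ denotes the set of positive integers, $P(\mathbb{Z}) = \{P(n) : n \in \mathbb{Z}\}$, and the complement of $S$ is $\mathbb{Z}^+ \setminus S$. A set $T \subseteq \mathbb{Z}^+$ is a ladder if every coloring of $\mathbb{Z}$ with finitely many colors contains arbitrarily long (finite) monochromatic arithmetic progressions whose common difference lies in $T$.
   Formalization: That S is a ladder is stated only for infinite S: for P = -x^2 the set S is empty, and a finite set is never a ladder; the claim about the complement is unrestricted. *)

(* Defs.v *)
From mathcomp Require Import all_boot all_order all_algebra.
From mathcomp Require Import boolp classical_sets functions cardinality.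

Set Implicit Arguments.
Unset Strict Implicit.
Unset Printing Implicit Defensive.

Import Order.TTheory GRing.Theory Num.Theory.

Local Open Scope classical_set_scope.
Local Open Scope ring_scope.

Definition pos_ints : set int := [set n : int | 0 < n].

Definition monochromatic_AP (C : finType) (c : int -> C) (a d : int) (k : nat) :
    Prop :=
  exists q : C, forall i : nat, (i < k)%N -> c (a + i%:Z * d) = q.

Definition ladder (T : set int) : Prop :=
  T `<=` pos_ints /\
  forall (C : finType) (c : int -> C) (k : nat),
    exists a d : int, T d /\ monochromatic_AP c a d k.

Definition positive_values (P : {poly int}) : set int :=
  [set P.[n] | n in [set: int]] `&` pos_ints.

(* Main.v *)
Require Import Defs.
From mathcomp Require Import all_boot all_order all_algebra.
From mathcomp Require Import boolp classical_sets functions cardinality.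
From mathcomp Require Import zify ring.

Set Implicit Arguments.
Unset Strict Implicit.
Unset Printing Implicit Defensive.

Import Order.TTheory GRing.Theory Num.Theory.

Local Open Scope classical_set_scope.
Local Open Scope ring_scope.

(** Both halves come from one polynomial van der Waerden theorem in which the
    argument is confined to a thick set [D] of integers, that is, one
    containing a translate of every finite set: for polynomials [p] vanishing
    at [0], every finite colouring of the integers has a point [a] and some
    [d] in [D] such that all the [a + p(d)] have the colour of [a]
    ([polynomial_vdw]).

    With the polynomials [i * P], [i < k], and [D = {n | 0 < P(n)}], it gives
    progressions with difference [P(d)] in [S]; when [S] is infinite, [P] is
    positive on a ray of integers, so [D] is thick.  With the polynomials
    [i * X] and [D] the complement of [S], it gives progressions with
    difference [d] outside [S]; this [D] is thick because [S] has density zero,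
    [P] growing faster than any linear function.

    The van der Waerden theorem is proved by colour focusing together with
    Bergelson's PET induction, following Walters.  Suppose that [a] is a point
    and [d_1, ..., d_r] are such that, for each [i], the points [a + p(d_i)]
    all have one colour [k_i], with the [k_i] distinct.  If the colour of [a] is
    some [k_i], then [a] and [d_i] are as wanted.  Otherwise, fix [p1] in the
    family and look for [x] such that the colouring near [b] is repeated near
    all the [b + q(x)], where [q] runs over the polynomials
    [p(d + X) - p(d) - p1(X)].  Then the point [b + a - p1(x)] is focused by
    [x, d_1 + x, ..., d_r + x] with one more colour, since
    [b + a - p1(x) + p(d + x) = (b + q(x)) + (a + p(d))].  More colours than
    there are is impossible, so this ends.  The new [q] form a simpler family
    when [p1] has least degree: leading coefficients in larger degrees are the
    same, and in the degree of [p1] there is one fewer.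

    Thickness costs nothing in this argument: the shifts [d] used at one stage
    lie in a finite set [Y] known beforehand, and the [x] such that [x] and
    [x + Y] are in [D] form a thick set again.  This is why the statement under
    induction also bounds [a] and [d] uniformly in the colouring. *)

(** * Thick sets *)

Definition thick (D : set int) : Prop :=
  forall F : seq int, exists x, forall t, t \in F -> D (x + t).

(** The lists [X] and [Y] are chosen before the colouring [c]: this uniformity
    is what allows a colouring of finite windows to have finitely many
    colours. *)
Definition vdw_family (A : seq {poly int}) : Prop :=
  forall (D : set int) (C : finType), thick D ->
  exists X Y : seq int, forall c : int -> C, exists a d,
    [/\ a \in X, d \in Y, D d & forall p, p \in A -> c (a + p.[d]) = c a].

(** Lets the focusing argument find a new [x] in [D] whose sums with all the
    shifts used before are in [D] as well. *)
Lemma thick_core (D : set int) (F : seq int) :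
  thick D -> thick [set x | D x /\ forall t, t \in F -> D (x + t)].
Proof.
move=> thD G.
have [x xD] := thD [seq g + t | g <- G, t <- 0 :: F].
exists x => g gG; split=> [|t tF]; last first.
  by rewrite -addrA; apply/xD/allpairs_f => //; rewrite inE tF orbT.
by rewrite -[g]addr0; apply/xD/allpairs_f => //; rewrite inE eqxx.
Qed.

(** * The induction on families of polynomials *)

(** Finitely supported sequences of naturals are well founded for the order
    that compares them at the last place where they differ. *)
Lemma lex_ind (Q : (nat -> nat) -> Prop) :
  (forall f, (forall g i, (g i < f i)%N ->
     (forall j, (i < j)%N -> g j = f j) -> Q g) -> Q f) ->
  forall n f, (forall i, (n <= i)%N -> f i = 0%N) -> Q f.
Proof.
move=> Qstep n f f0.
(* [above m]: it suffices to have [Q] below [f] when the last difference is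
   at place [m] or later; for [m = n] no such difference exists. *)
have above m : forall f, (forall g i, (m <= i)%N -> (g i < f i)%N ->
    (forall j, (i < j)%N -> g j = f j) -> Q g) -> Q f.
  elim: m => [|m IHm] {f0}f Hf.
    by apply: Qstep => g i; apply: Hf.
  have [v fv] := ubnP (f m).
  elim: v => // v IHv in f Hf fv *.
  apply: IHm => g i; rewrite leq_eqVlt => /predU1P[<-|mi] gf gE; last exact: Hf gE.
  apply: IHv => [h i' mi' hg hE|]; last lia.
  apply: (Hf _ i') => //; first by rewrite -gE.
  by move=> j i'j; rewrite hE // gE //; lia.
by apply: (above n) => g i /f0->.
Qed.

(** A polynomial of degree [i] has size [i.+1], so that zero polynomials appear
    in no [leads A i]. *)
Definition leads (A : seq {poly int}) (i : nat) : seq int :=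
  [seq lead_coef p | p : {poly int} <- A & size p == i.+1].

Definition weight (A : seq {poly int}) (i : nat) : nat := size (undup (leads A i)).

(** The constant [p.[d]] is removed so that the new polynomials vanish at [0];
    [p1] is subtracted so that those with its leading term drop in degree. *)
Definition recentred (p1 p : {poly int}) (d : int) : {poly int} :=
  p \Po ('X + d%:P) - p.[d]%:P - p1.

Lemma leadsP (A : seq {poly int}) i v :
  reflect (exists p : {poly int}, [/\ p \in A, size p = i.+1 & lead_coef p = v]) (v \in leads A i).
Proof.
apply: (iffP mapP) => [[p]|[p [pA sp <-]]].
  by rewrite mem_filter => /andP[/eqP sp pA] ->; exists p.
by exists p => //; rewrite mem_filter sp eqxx.
Qed.

Lemma eq_weight (A B : seq {poly int}) i : leads A i =i leads B i -> weight A i = weight B i.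
Proof.
move=> AB; apply/perm_size/uniq_perm; rewrite ?undup_uniq // => v.
by rewrite !mem_undup.
Qed.

Lemma horner_recentred p1 p d x :
  (recentred p1 p d).[x] = p.[d + x] - p.[d] - p1.[x].
Proof. by rewrite /recentred !hornerD !hornerN horner_comp hornerD hornerX !hornerC [x + d]addrC. Qed.

Lemma size_shift (p : {poly int}) d : (1 < size p)%N ->
  size (p \Po ('X + d%:P) - p.[d]%:P) = size p /\
  lead_coef (p \Po ('X + d%:P) - p.[d]%:P) = lead_coef p.
Proof.
move=> p1.
have sX : size ('X + d%:P) = 2%N by rewrite size_XaddC.
have sp : size (p \Po ('X + d%:P)) = size p by rewrite size_comp_poly2.
have lt : (size (- p.[d]%:P) < size (p \Po ('X + d%:P)))%N.
  by rewrite size_polyN sp (leq_ltn_trans (size_polyC_leq1 _)).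
rewrite size_polyDl // lead_coefDl // sp lead_coef_comp ?sX //.
by rewrite lead_coefXaddC expr1n mulr1.
Qed.

Lemma recentred_gt (p1 p : {poly int}) d : (1 < size p)%N -> (size p1 < size p)%N ->
  size (recentred p1 p d) = size p /\ lead_coef (recentred p1 p d) = lead_coef p.
Proof.
move=> sp lt; have [s l] := size_shift d sp.
rewrite /recentred; move: (_ - p.[d]%:P) s l => r s l.
by rewrite size_polyDl ?lead_coefDl ?size_polyN ?s ?l.
Qed.

Lemma recentred_eq (p1 p : {poly int}) d : (1 < size p)%N -> size p = size p1 ->
  (size (recentred p1 p d) <= size p1)%N /\
  (size (recentred p1 p d) = size p1 ->
     lead_coef (recentred p1 p d) = lead_coef p - lead_coef p1).
Proof.
move=> sp eq; have [s l] := size_shift d sp.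
split.
  by rewrite /recentred (leq_trans (size_polyD _ _)) // size_polyN s eq maxnn.
move=> eqs; rewrite [LHS]lead_coefE eqs /recentred coefB.
by rewrite -[in X in X - _]eq -[in X in X - _]s -!lead_coefE l.
Qed.

(** Shifting the argument keeps degree and leading coefficient, so subtracting
    [p1] only acts on degree [e]: the leading coefficients there are translated
    by that of [p1], which itself is translated to [0] and disappears.  Degrees
    below [e] may get many new members. *)
Lemma weight_recentred (A : seq {poly int}) (p1 : {poly int}) Y :
  (forall p, p \in A -> (1 < size p)%N) -> p1 \in A ->
  (forall p, p \in A -> (size p1 <= size p)%N) ->
  let B := [seq recentred p1 p d | p <- A, d <- 0 :: Y] in
  let e := (size p1).-1 in
  (weight B e < weight A e)%N /\
  forall j, (e < j)%N -> weight B j = weight A j.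
Proof.
move=> A1 p1A minp1 B e.
have se : size p1 = e.+1 by rewrite /e prednK // ltnW // A1.
split; last first.
  move=> j ej; apply: eq_weight => v; apply/leadsP/leadsP.
    case=> q [/allpairsP[[p d] /= [pA _ ->]]] sq <-; exists p.
    have := minp1 p pA; rewrite leq_eqVlt => /predU1P[eqp|ltp].
      by have [] := recentred_eq d (A1 p pA) (esym eqp); rewrite sq se ltnS leqNgt ej.
    by have [s l] := recentred_gt d (A1 p pA) ltp; rewrite -s l.
  case=> p [pA sp <-]; exists (recentred p1 p 0).
  have [||s l] := @recentred_gt p1 p 0; [exact: A1|by rewrite se sp|].
  by rewrite s l; split=> //; apply: allpairs_f => //; rewrite inE eqxx.
have l1 : lead_coef p1 \in undup (leads A e).
  by rewrite mem_undup; apply/leadsP; exists p1.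
(* The translated leading coefficients, without the one that vanishes. *)
pose s := [seq v - lead_coef p1 | v <- rem (lead_coef p1) (undup (leads A e))].
have <- : (size s).+1 = weight A e.
  rewrite size_map size_rem // prednK // lt0n size_eq0.
  by apply: contraL l1 => /eqP->.
rewrite ltnS; apply: uniq_leq_size (undup_uniq _) _ => v.
rewrite mem_undup => /leadsP[q [/allpairsP[[p d] /= [pA _ ->]]] sq <-].
have := minp1 p pA; rewrite leq_eqVlt => /predU1P[eqp|ltp]; last first.
  by have [sp _] := recentred_gt d (A1 p pA) ltp; rewrite -sp sq se ltnn in ltp.
have [_ /(_ _)lq] := recentred_eq d (A1 p pA) (esym eqp).
rewrite lq ?sq ?se //; apply: map_f.
rewrite (rem_filter _ (undup_uniq _)) mem_filter /= mem_undup; apply/andP; split.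
  apply/eqP => ll; have := lq; rewrite sq se ll subrr => /(_ erefl)/eqP.
  by rewrite lead_coef_eq0 -size_poly_eq0 sq.
by apply/leadsP; exists p; rewrite -eqp.
Qed.

(** * Colour focusing *)

Definition focused (C : finType) (A : seq {poly int}) (D : set int) (X Y : seq int) (c : int -> C)
    (a : int) (ks : seq C) : Prop :=
  [/\ a \in X, uniq ks & forall k, k \in ks ->
     exists d, [/\ d \in Y, D d & forall p, p \in A -> c (a + p.[d]) = k]].

(** Either the wanted configuration or [r] focused colours; the induction on
    [r] trades a point focused with [r] colours for a translate focused with
    [r.+1]. *)
Lemma focusing (A : seq {poly int}) (p1 : {poly int}) (C : finType) (D : set int) r :
  thick D ->
  (forall Y, vdw_family [seq recentred p1 p d | p <- A, d <- 0 :: Y]) ->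
  (forall p, p \in A -> p.[0] = 0) ->
  exists X Y : seq int, forall c : int -> C,
    (exists a d,
      [/\ a \in X, d \in Y, D d & forall p, p \in A -> c (a + p.[d]) = c a]) \/
    (exists a ks, size ks = r /\ focused A D X Y c a ks).
Proof.
move=> thD Bvdw A0.
elim: r => [|r [X [Y IH]]].
  by exists [:: 0], [::] => c; right; exists 0, [::]; split.
(* The offsets from [b] whose colours have to be repeated at [b + q(x)]. *)
pose os := X ++ [seq a + t | a <- X, t <- [seq p.[d] | p <- A, d <- Y]].
have [X' [Y' B]] := Bvdw Y _ ((size os).-tuple C : finType) (thick_core Y thD).
exists ([seq b + a | b <- X', a <- X] ++
        [seq b - p1.[x] | b <- [seq b + a | b <- X', a <- X], x <- Y']).
exists (Y ++ Y' ++ [seq x + d | x <- Y', d <- Y]) => c.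
have [b [x [bX xY [xD xYD] winE]]] := B (fun b => map_tuple (fun t => c (b + t)) (in_tuple os)).
have recolor p d t : p \in A -> d \in 0 :: Y -> t \in os ->
    c (b - p1.[x] + (p.[d + x] - p.[d]) + t) = c (b + t).
  move=> pA dY tos.
  have /(congr1 val)/= := winE _ (allpairs_f (fun p d => recentred p1 p d) pA dY).
  move/eq_in_map => /(_ t tos) <-; rewrite horner_recentred; congr c; ring.
(* The inductive hypothesis is applied to the colouring seen from [b]. *)
have [[a [d [aX dY Dd aE]]]|[a [ks [sks [aX uks kfoc]]]]] := IH (fun t => c (b + t)).
  left; exists (b + a), d; split=> //.
  - by rewrite mem_cat allpairs_f.
  - by rewrite mem_cat dY.
  by move=> p pA; rewrite -addrA aE.
have aos : a \in os by rewrite mem_cat aX.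
have [/kfoc[d [dY Dd dE]]|aks] := boolP (c (b + a) \in ks).
  left; exists (b + a), d; split=> //.
  - by rewrite mem_cat allpairs_f.
  - by rewrite mem_cat dY.
  by move=> p pA; rewrite -addrA dE.
right; exists (b + a - p1.[x]), (c (b + a) :: ks); split; first by rewrite /= sks.
split.
- rewrite mem_cat; apply/orP; right.
  by apply: (allpairs_f (fun b x => b - p1.[x])) => //; apply: allpairs_f.
- by rewrite /= aks.
move=> k; rewrite inE => /predU1P[->|/kfoc[d [dY Dd dE]]].
  (* The colour of the old focus is reached with the shift [d = 0]. *)
  exists x; split=> // [|p pA]; first by rewrite !mem_cat xY orbT.
  rewrite -(recolor p 0 a) ?inE ?eqxx // add0r (A0 p pA); congr c; ring.
exists (x + d); split.
- by rewrite !mem_cat allpairs_f ?orbT.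
- exact: xYD.
move=> p pA; rewrite -(dE p pA) -(recolor p d (a + p.[d])) ?inE ?dY ?orbT //.
  by rewrite [d + x]addrC; congr c; ring.
by rewrite mem_cat; apply/orP; right; do 2?apply: allpairs_f.
Qed.

(** A point cannot be focused with more colours than there are. *)
Lemma vdw_family_recentred (A : seq {poly int}) p1 :
  (forall p, p \in A -> p.[0] = 0) ->
  (forall Y, vdw_family [seq recentred p1 p d | p <- A, d <- 0 :: Y]) ->
  vdw_family A.
Proof.
move=> A0 Bvdw D C thD.
have [X [Y XY]] := focusing C #|C|.+1 thD Bvdw A0.
exists X, Y => c; have [//|[a [ks [sks [_ uks _]]]]] := XY c.
by have := max_card (mem ks); rewrite (card_uniqP uks) sks ltnn.
Qed.

(** Zero polynomials arise in the recentred families (from [p = p1], [d = 0])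
    and have to be discarded: recentring the zero polynomial would give [- p1],
    with a new leading coefficient in the least degree. *)
Lemma vdw_family_nonzero (A : seq {poly int}) :
  vdw_family [seq p <- A | p != 0] -> vdw_family A.
Proof.
move=> Avdw D C /Avdw-/(_ C)[X [Y XY]]; exists X, Y => c.
have [a [d [aX dY Dd adE]]] := XY c; exists a, d; split=> // p pA.
have [->|p0] := eqVneq p 0; first by rewrite horner0 addr0.
by apply: adE; rewrite mem_filter p0.
Qed.

Lemma exists_min_size (A : seq {poly int}) p0 : p0 \in A ->
  exists2 p1, p1 \in A & forall p, p \in A -> (size p1 <= size p)%N.
Proof.
move=> p0A; have ex : exists n, has (fun p : {poly int} => size p == n) A.
  by exists (size p0); apply/hasP; exists p0.
have [_ /hasP[p1 p1A /eqP<-] min] := ex_minnP ex; exists p1 => // p pA.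
by apply: min; apply/hasP; exists p.
Qed.

Lemma weight_support (A : seq {poly int}) :
  exists n, forall i, (n <= i)%N -> weight A i = 0%N.
Proof.
exists (\max_(p <- A) size p) => i le_i; apply/eqP; rewrite size_eq0.
apply/eqP; case E: (undup _) => [//|v s].
have : v \in undup (leads A i) by rewrite E inE eqxx.
rewrite mem_undup => /leadsP[p [pA sp _]].
by have := @leq_bigmax_seq _ _ predT (fun p : {poly int} => size p) p pA isT; rewrite sp ltnNge le_i.
Qed.

(** Induction on the weight, taking [p1] of least degree in the family. *)
Theorem polynomial_vdw (A : seq {poly int}) :
  (forall p, p \in A -> p.[0] = 0) -> vdw_family A.
Proof.
pose Q f := forall A : seq {poly int}, weight A =1 f ->
    (forall p, p \in A -> p.[0] = 0) -> vdw_family A.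
have [n wn] := weight_support A.
suff /(_ n _ wn) : forall n f, (forall i, (n <= i)%N -> f i = 0%N) -> Q f by exact.
apply: lex_ind => f IH {n wn}A wA A0.
apply: vdw_family_nonzero; set A' := filter _ _.
have A'0 p : p \in A' -> p.[0] = 0 by rewrite mem_filter => /andP[_ /A0].
have wA' : weight A' =1 f.
  move=> i; rewrite -wA; apply: eq_weight => v.
  apply/leadsP/leadsP => -[p [pA sp lp]]; exists p; split=> //.
    by move: pA; rewrite mem_filter => /andP[].
  by rewrite mem_filter pA -size_poly_eq0 sp.
have A'1 p : p \in A' -> (1 < size p)%N.
  move=> pA'; rewrite ltnNge; apply/negP => /size1_polyC pE.
  move: (pA'); rewrite mem_filter => /andP[/eqP[]].
  by rewrite pE; move: (A'0 p pA'); rewrite [in X in X -> _]pE hornerC => ->.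
move: A'0 A'1 wA'; case: A' => [|p0 A'']; last set A' := _ :: _.
  move=> _ _ _ D C thD; have [x xD] := thD [:: 0].
  by exists [:: 0], [:: x + 0] => c; exists 0, (x + 0); rewrite !inE; split=> //; apply: xD; rewrite inE.
move=> A'0 A'1 wA'; have [p1 p1A minp1] := @exists_min_size A' p0 (mem_head _ _).
apply: (@vdw_family_recentred _ p1) => // Y.
have [lt eq] := weight_recentred Y A'1 p1A minp1.
rewrite wA' in lt; apply: (IH _ _ lt) => // [j /eq->|]; first exact: wA'.
by move=> _ /allpairsP[[p d] /= [pA _ ->]]; rewrite horner_recentred addr0 (A'0 p1) // !subrr.
Qed.

(** * Growth of integer polynomials *)

Lemma poly_eventually_gt0 (P : {poly int}) : 0 < lead_coef P ->
  exists B : nat, forall n : int, B%:Z <= n -> 0 < P.[n].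
Proof.
elim/poly_ind: P => [|P c IH]; first by rewrite lead_coef0 ltxx.
have [->|P0] := eqVneq P 0.
  by rewrite mul0r add0r lead_coefC => c0; exists 0%N => n _; rewrite hornerC.
have lt : (size c%:P < size (P * 'X)%R)%N.
  by rewrite size_mulX // ltnS (leq_trans (size_polyC_leq1 _)) ?size_poly_gt0.
rewrite lead_coefDl // lead_coefMX => /IH[B BP].
(* Past [B] the value [P.[n]] is a positive integer, so [P.[n] * n >= n],
   which exceeds [- c]. *)
exists (B + `|c| + 1)%N => n Bn; rewrite !hornerE.
have ? := BP n ltac:(lia).
have : 1 * n <= P.[n] * n by apply: ler_wpM2r; lia.
rewrite mul1r; move: (P.[n] * n) => y; lia.
Qed.

(** For [e = 1] or [e = -1]: a ray in either direction is thick. *)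
Lemma thick_image_ray (e : int) (D : set int) (B : nat) :
  e * e = 1 -> (forall n : int, B%:Z <= n -> D (e * n)) -> thick D.
Proof.
move=> ee DB F; set m := \max_(t <- F) `|t|%N.
exists (e * (B + m)%N%:Z) => t tF.
have tm : (`|t| <= m)%N by apply: (@leq_bigmax_seq _ _ predT absz).
have -> : e * (B + m)%N%:Z + t = e * ((B + m)%N%:Z + e * t).
  by rewrite mulrDr mulrA ee mul1r.
apply: DB; have : absz (e * t) = absz t.
  have /eqP : (absz e * absz e)%N = 1%N by rewrite -abszM ee.
  by rewrite muln_eq1 abszM => /andP[/eqP-> _]; rewrite mul1n.
lia.
Qed.

Lemma poly_eventually_sign (P : {poly int}) : P != 0 -> exists B : nat,
  (forall n : int, B%:Z <= n -> 0 < P.[n]) \/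
  (forall n : int, B%:Z <= n -> P.[n] < 0).
Proof.
rewrite -lead_coef_eq0; case: ltgtP => // lP _; last first.
  by have [B BP] := poly_eventually_gt0 lP; exists B; left.
have [|B BP] := @poly_eventually_gt0 (- P); first by rewrite lead_coefN oppr_gt0.
by exists B; right => n /BP; rewrite hornerN oppr_gt0.
Qed.

(** [P] has a constant sign near each end of the integers; were it negative at
    both ends, it would take only finitely many positive values. *)
Lemma thick_positive_arguments (P : {poly int}) :
  infinite_set (positive_values P) -> thick [set n | 0 < P.[n]].
Proof.
move=> infP.
have P0 : P != 0.
  apply/eqP => P0; apply: infP; rewrite (_ : positive_values P = set0) //.
  by apply/seteqP; split=> // _ [[n _ <-]]; rewrite /pos_ints /= P0 horner0.
have R0 : P \Po - 'X != 0 by rewrite comp_poly_eq0 // size_polyN size_polyX.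
have [B [Bpos|Bneg]] := poly_eventually_sign P0.
  by apply: (@thick_image_ray 1 _ B) => // n /Bpos; rewrite /= mul1r.
have [B' [B'pos|B'neg]] := poly_eventually_sign R0.
  apply: (@thick_image_ray (-1) _ B') => // n /B'pos.
  by rewrite horner_comp hornerN hornerX /= mulN1r.
case: infP; set m := (B + B')%N.
pose s := [seq P.[i%:Z - m%:Z] | i <- iota 0 (2 * m)].
apply: (@sub_finite_set _ _ [set` s]); last exact: finite_seq.
move=> _ [[n _ <-]]; rewrite /pos_ints /= => Pn.
have nB : n < B%:Z by rewrite ltNge; apply/negP => /Bneg; lia.
have nB' : - n < B'%:Z.
  rewrite ltNge; apply/negP => /B'neg; rewrite horner_comp hornerN hornerX opprK.
  by move/(lt_trans Pn); rewrite ltxx.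
apply/mapP; exists (absz (n + m%:Z)); first by rewrite mem_iota; lia.
by congr (P.[_]); lia.
Qed.

(** In degree at least two, subtracting [K * X] does not change the leading
    term of [P] or of [- P]. *)
Lemma poly_superlinear (P : {poly int}) (K : nat) : (2 < size P)%N ->
  exists B : nat, forall n : int, B%:Z <= n -> K%:Z * n <= `|P.[n]|.
Proof.
move=> sP.
have lt : (size (- (K%:Z *: 'X) : {poly int})%R < size P)%N.
  rewrite size_polyN (leq_ltn_trans (size_scale_leq _ _)) // size_polyX //.
have main (R : {poly int}) : size R = size P -> 0 < lead_coef R ->
    exists B : nat, forall n : int, B%:Z <= n -> K%:Z * n <= R.[n].
  move=> sR lR; have [|B BP] := @poly_eventually_gt0 (R - K%:Z *: 'X).
    by rewrite lead_coefDl // sR.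
  by exists B => n /BP; rewrite hornerD hornerN hornerZ hornerX subr_gt0 => /ltW.
have : lead_coef P != 0 by rewrite lead_coef_eq0 -size_poly_gt0 (leq_trans _ sP).
case: ltgtP => // lP _; last first.
  by have [B BP] := main P erefl lP; exists B => n /BP/le_trans; apply; exact: ler_norm.
have [||B BP] := main (- P); rewrite ?size_polyN ?lead_coefN ?oppr_gt0 //.
by exists B => n /BP/le_trans; apply; rewrite hornerN -normrN ler_norm.
Qed.

Lemma poly_superlinear_abs (P : {poly int}) (K : nat) : (2 < size P)%N ->
  exists B : nat, forall n : int, (B <= `|n|)%N -> (K * `|n| <= `|P.[n]|)%N.
Proof.
move=> sP; have [B BP] := poly_superlinear K sP.
have [|B' B'P] := @poly_superlinear (P \Po - 'X) K.
  by rewrite size_comp_poly2 // size_polyN size_polyX.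
exists (B + B')%N => n Bn; rewrite -lez_nat PoszM !abszE.
have [n0|n0] := ger0P n; first by apply: BP; lia.
by have := B'P (- n); rewrite horner_comp hornerN hornerX opprK; apply; lia.
Qed.

(** If every translate of [F] far to the right met the values of [P], then each
    [x < N] would be [P.[n] - t - T] with [t] in [F] and [n] small: as
    [|P.[n]|] is at least [4 (f + 1) |n|], there are only about
    [2 N / (4 (f + 1))] such [n], hence at most about [N / 2] pairs [(n, t)]. *)
Lemma thick_complement_values (P : {poly int}) : (2 < size P)%N ->
  thick (pos_ints `\` positive_values P).
Proof.
move=> sP F.
(* Translates start beyond [T] in order to be positive. *)
pose f := size F; pose T := (\max_(t <- F) `|t|%N).+1.
have le_T t : t \in F -> (`|t| < T)%N.
  by move=> tF; rewrite ltnS; apply: (@leq_bigmax_seq _ _ predT absz).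
have [B BP] := @poly_superlinear_abs P (4 * f.+1) sP.
apply: contrapT => noP.
have hit x : exists n t, t \in F /\ P.[n] = T%:Z + x%:Z + t.
  apply: contrapT => none; apply: noP; exists (T%:Z + x%:Z) => t tF.
  have ? := le_T t tF; split; first by rewrite /pos_ints /=; lia.
  by move=> [[n _ nE] _]; apply: none; exists n, t.
(* [b] bounds the relevant [n], whether or not the lower bound for [P]
   applies to them, and [m] is such that [(2 * b).+1 < 4 * m]. *)
pose m := (B + T).+1; pose b := (m + T)%N; pose N := (4 * f.+1 * m)%N.
pose s := [seq P.[n] - t - T%:Z | n <- [seq i%:Z - b%:Z | i <- iota 0 (2 * b).+1], t <- F].
have : (size [seq i%:Z | i <- iota 0 N] <= size s)%N.
  apply: uniq_leq_size; first by rewrite map_inj_uniq ?iota_uniq // => ? ? [].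
  move=> _ /mapP[x xN ->]; have [n [t [tF nE]]] := hit x.
  have -> : x%:Z = P.[n] - t - T%:Z by rewrite nE; lia.
  apply: (allpairs_f (fun n t => P.[n] - t - T%:Z)) => //.
  have nb : (`|n| <= b)%N.
    rewrite leqNgt; apply/negP => bn.
    have /BP : (B <= `|n|)%N by lia.
    have : (4 * f.+1 * b.+1 <= 4 * f.+1 * `|n|)%N by rewrite leq_mul2l bn orbT.
    have : (N + 2 * T <= 4 * f.+1 * b.+1)%N.
      by rewrite /b -addnS mulnDr leq_add2l leq_mul //; lia.
    have := le_T t tF; move: xN; rewrite mem_iota nE; lia.
  by apply/mapP; exists (absz (n + b%:Z)); rewrite ?mem_iota; lia.
rewrite size_map size_iota size_allpairs size_map size_iota leqNgt => /negP[].
have : ((2 * b).+1 * f < (4 * m) * f.+1)%N.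
  by rewrite (@leq_ltn_trans ((4 * m) * f)) ?ltn_mul2l ?leq_mul //; lia.
by rewrite /N mulnAC.
Qed.

(** * Ladders *)

(* [size P] is the degree plus one. The set of positive values is finite
   exactly when [P] has even degree and a negative leading coefficient (for
   example it is empty for [P = - 'X^2]), and a finite set is never a ladder. *)
Theorem corollary2p11 (P : {poly int}) (S : set int)
    (hS : S = positive_values P)
    (hdeg : (2 <= (size P).-1)%N)
    (hP0 : P.[0] = 0) :
  (infinite_set S -> ladder S) /\ ladder (pos_ints `\` S).
Proof.
rewrite {}hS; split=> [infS|].
  split=> [d []//|C c k].
  pose A := [seq i%:Z *: P | i <- iota 0 k].
  have A0 p : p \in A -> p.[0] = 0.
    by move=> /mapP[i _ ->]; rewrite hornerZ hP0 mulr0.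
  have [X [Y /(_ c)[a [n [_ _ Pn0 anE]]]]] :=
    polynomial_vdw A0 C (thick_positive_arguments infS).
  exists a, P.[n]; split; first by split=> //; exists n.
  exists (c a) => i ik; rewrite -hornerZ anE //.
  by apply: map_f; rewrite mem_iota.
split=> [d []//|C c k]; have sP : (2 < size P)%N by lia.
pose A := [seq i%:Z *: ('X : {poly int}) | i <- iota 0 k].
have A0 p : p \in A -> p.[0] = 0.
  by move=> /mapP[i _ ->]; rewrite hornerZ hornerX mulr0.
have [X [Y /(_ c)[a [d [_ _ Sd adE]]]]] :=
  polynomial_vdw A0 C (thick_complement_values sP).
exists a, d; split=> //; exists (c a) => i ik.
rewrite -[in LHS](hornerX d) -hornerZ adE //.
by apply: map_f; rewrite mem_iota.
Qed.
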